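(* There is a separable metric space $X$ of diameter one for which $S'(X)$ is not a Choquet simplex. Hence the assertion that $S'(X)$ is a simplex for every separable metric space $X$ (of diameter at most one) is false.
   Context: The construction $S'$: Let $(X,d)$ be a nonempty separable metric space with $\operatorname{diam}(X)\le 1$. For a sequence $D=(d_n)_{n\ge 1}$ (repetitions allowed) whose terms form a dense subset of $X$, put $\iota_D:X\to[0,1]^{\mathbb{N}}$, $\iota_D(x)=(d(x,d_1),d(x,d_2),\ldots)$, and let $S'_D(X)$ be the closed convex hull of $\iota_D(X)$ in $[0,1]^{\mathbb{N}}$ (product topology). Up to affine homeomorphism $S'_D(X)$ does not depend on the choice of $D$ (a known result of Sabok), and $S'(X)$ denotes $S'_D(X)$ for any such $D$. A compact metrizable convex set $K$ (in a Hausdorff locally convex space) is a (Choquet) simplex if each point of $K$ is the barycenter of a unique Borel probability measure carried by the set $\operatorname{ext}(K)$ of extreme points of $K$. *)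

(* Defs.v *)
From HB Require Import structures.
From mathcomp Require Import all_boot all_order all_algebra.
From mathcomp Require Import all_classical all_reals all_analysis.

Set Implicit Arguments.
Unset Strict Implicit.
Unset Printing Implicit Defensive.

Import Order.TTheory GRing.Theory Num.Theory.
Import numFieldNormedType.Exports.

Local Open Scope classical_set_scope.
Local Open Scope ring_scope.

Definition metrizable (R : realType) (T : topologicalType) :=
  exists d : T -> T -> R,
    [/\ forall x y, 0 <= d x y,
        forall x y, d x y = 0 <-> x = y,
        forall x y, d x y = d y x,
        forall x y z, d x z <= d x y + d y z &
        forall (x : T) (U : set T),
          nbhs x U <-> exists2 e, 0 < e & [set y | d x y < e] `<=` U].

Lemma pseudometric_metrizable (R : realType) (T : pseudoMetricType R) :
  hausdorff_space T -> metrizable R T.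
Proof.
move=> hT.
pose S (x y : T) := [set e : R | 0 < e /\ (e = 1 \/ ball x e y)].
have S0 x y : S x y !=set0 by exists 1; split=> //; left.
have Slb x y : lbound (S x y) 0 by move=> e [/ltW].
have hlb x y : has_lbound (S x y) by exists 0.
have dlt x y e : e <= 1 -> 0 < e -> inf (S x y) < e <-> exists2 r, r < e & 0 < r /\ ball x r y.
  move=> e1 e0; split.
    move=> /(inf_lt (S0 x y))[r [r0 [->|rb]] re]; last by exists r.
    by move: re; rewrite ltNge e1.
  move=> [r re [r0 rb]]; apply: le_lt_trans re.
  by apply: ge_inf => //; split=> //; right.
have le1 x y : inf (S x y) <= 1 by apply: ge_inf => //; split=> //; left.
have ge0 x y : 0 <= inf (S x y) by exact: lb_le_inf.
exists (fun x y => inf (S x y)); split.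
- exact: ge0.
- move=> x y; split=> [xy0|->].
    apply: (close_eq hT); rewrite ball_close => e.
    have [e1|e1] := leP e%:num 1.
      have /dlt : inf (S x y) < e%:num by rewrite xy0.
      by case=> // r re [r0]; apply: le_ball; exact: ltW.
    have /dlt : inf (S x y) < 1 by rewrite xy0.
    by case=> // r re [r0]; apply: le_ball; exact/ltW/(lt_trans re).
  apply/eqP; rewrite eq_le ge0 andbT; apply/ler_addgt0Pl => e e0; rewrite addr0.
  by apply: ge_inf => //; split=> //; right; exact: ballxx.
- move=> x y; congr inf; apply/seteqP; split=> e [e0 [->|/ball_sym xy]];
    by split=> //; tauto.
- move=> x y z; apply/ler_addgt0Pl => e e0.
  have [r1 [r10 r1b] r1e] : exists2 r, S x y r & r < inf (S x y) + e / 2.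
    by apply: (inf_lt (S0 x y)); rewrite ltrDl divr_gt0.
  have [r2 [r20 r2b] r2e] : exists2 r, S y z r & r < inf (S y z) + e / 2.
    by apply: (inf_lt (S0 y z)); rewrite ltrDl divr_gt0.
  have r12 : r1 + r2 <= e + (inf (S x y) + inf (S y z)).
    rewrite (le_trans (lerD (ltW r1e) (ltW r2e)))// addrACA -splitr addrC//.
  apply: le_trans r12.
  case: r1b => [->|r1b]; first by rewrite (le_trans (le1 _ _))// lerDl ltW.
  case: r2b => [->|r2b]; first by rewrite (le_trans (le1 _ _))// lerDr ltW.
  apply: ge_inf => //; split; first exact: addr_gt0.
  by right; exact: ball_triangle r2b.
- move=> x U; rewrite nbhs_ballP; split=> [[e /= e0 eU]|[e e0 eU]].
    exists (Num.min e 1); first by rewrite lt_min e0 ltr01.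
    move=> y /dlt; rewrite ge_min lexx orbT lt_min e0 ltr01 => /(_ isT isT)[r].
    rewrite lt_min => /andP[re _] [r0 rb]; apply: eU.
    by apply: le_ball rb; exact: ltW.
  have m0 : 0 < Num.min e 1 by rewrite lt_min e0 ltr01.
  exists (Num.min e 1 / 2); first by rewrite /= divr_gt0.
  move=> y yb; apply: eU => /=.
  apply: (@lt_le_trans _ _ (Num.min e 1)); last by rewrite ge_min lexx.
  apply/dlt => //; first by rewrite ge_min lexx orbT.
  exists (Num.min e 1 / 2); last by split=> //; rewrite divr_gt0.
  by rewrite ltr_pdivrMr// ltr_pMr// ltr1n.
Qed.

Definition separable (T : topologicalType) :=
  exists2 D : set T, countable D & dense D.

Definition diam (R : realType) (X : metricType R) : \bar R :=
  ereal_sup [set (mdist p.1 p.2)%:E | p in [set: X * X]].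

(* The measurable structure on a generated sigma-algebra requires a pointed
   carrier; a vector space is pointed by its origin. *)
Definition pointed_tvs (R : numFieldType) (E : tvsType R) : Type := E.

HB.instance Definition _ (R : numFieldType) (E : tvsType R) :=
  Choice.on (pointed_tvs E).
HB.instance Definition _ (R : numFieldType) (E : tvsType R) :=
  isPointed.Build (pointed_tvs E) (0 : E).

Definition borel_tvs (R : numFieldType) (E : tvsType R) :=
  g_sigma_algebraType (@open E : set (set (pointed_tvs E))).

HB.instance Definition _ (R : numFieldType) (E : tvsType R) :=
  Measurable.on (borel_tvs E).

Section choquet.
Variables (R : realType) (E : tvsType R).
Implicit Types (A K : set E) (x y z : E) (mu nu : probability (borel_tvs E) R).

Definition closed_convex_hull A : set E :=
  smallest [set C : set E | closed C /\ convex_set C] A.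

Definition extreme_points K : set E :=
  [set x | K x /\ forall y z (t : R), K y -> K z -> 0 < t < 1 ->
     x = t *: y + (1 - t) *: z -> y = x /\ z = x].

Definition is_barycenter mu x :=
  forall f : {linear E -> R^o}, continuous f ->
    (\int[mu]_y (f y)%:E = (f x)%:E)%E.

(* For K compact, convex and metrizable, ext K is a G_delta of K, hence a Borel
   subset of E, so this says mu (ext K) = 1. *)
Definition carried_by_extreme_points K mu :=
  mu.-negligible (~` extreme_points K).

Definition uniquely_represented K x :=
  exists mu, [/\ carried_by_extreme_points K mu, is_barycenter mu x &
    forall nu, carried_by_extreme_points K nu -> is_barycenter nu x ->
      forall B, measurable B -> nu B = mu B].

Definition choquet_simplex K :=
  [/\ hausdorff_space E, convex_set K, compact K, metrizable R K &
      forall x, K x -> uniquely_represented K x].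

End choquet.

Definition RN (R : realType) : Type := {ptws nat -> R^o}.

Section RN_tvs.
Variable R : realType.

HB.instance Definition _ := PseudoMetric.on (RN R).
HB.instance Definition _ := GRing.Lmodule.copy (RN R) (nat -> R^o).

Lemma RN_cvgP (F : set_system (RN R)) (u : RN R) : Filter F ->
  F --> u <-> forall n, (fun v : RN R => v n : R^o) @ F --> (u n : R^o).
Proof.
move=> FF; split=> [Fu n|Fu].
  apply: cvg_trans (cvg_app _ Fu) _.
  exact: (@proj_continuous nat (fun=> R^o) n u).
apply/cvg_sup => n A /= [_ [[B oB <-] Bu] BA].
by apply: filterS BA _; apply: Fu; exact: open_nbhs_nbhs.
Qed.

Lemma RN_proj_continuous n : continuous (fun u : RN R => u n : R^o).
Proof. by move=> u; have /RN_cvgP : nbhs u --> u by []; exact. Qed.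

Lemma RN_cvg_coord (T : Type) (F : set_system T) (f : T -> RN R) (u : RN R) n :
  Filter F -> f @ F --> u -> (fun x => f x n : R^o) @ F --> (u n : R^o).
Proof.
move=> FF fu; have FfF : Filter (f @ F) by apply: fmap_filter.
exact: (proj1 (@RN_cvgP (f @ F) u FfF) fu n).
Qed.

Let RN_add_continuous : continuous (fun u : RN R * RN R => u.1 + u.2).
Proof.
move=> u; have Fu : Filter (nbhs u) by apply: nbhs_filter.
have FF : Filter ((fun v : RN R * RN R => v.1 + v.2) @ u) by apply: fmap_filter.
apply: (proj2 (@RN_cvgP _ (u.1 + u.2) FF)) => n.
have h1 := @RN_cvg_coord _ _ _ _ n Fu (@cvg_fst _ _ (nbhs u.1) (nbhs u.2) (nbhs_filter _)).
have h2 := @RN_cvg_coord _ _ _ _ n Fu (@cvg_snd _ _ (nbhs u.1) (nbhs u.2) (nbhs_filter _)).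
exact: (@cvgD R R^o _ _ Fu _ _ _ _ h1 h2).
Qed.

Let RN_scale_continuous : continuous (fun z : R^o * RN R => z.1 *: z.2).
Proof.
move=> z; have Fz : Filter (nbhs z) by apply: nbhs_filter.
have FF : Filter ((fun v : R^o * RN R => v.1 *: v.2) @ z) by apply: fmap_filter.
apply: (proj2 (@RN_cvgP _ (z.1 *: z.2) FF)) => n.
have h1 : fst @ z --> z.1 := @cvg_fst _ _ (nbhs z.1) (nbhs z.2) (nbhs_filter _).
have h2 := @RN_cvg_coord _ _ _ _ n Fz (@cvg_snd _ _ (nbhs z.1) (nbhs z.2) (nbhs_filter _)).
exact: (@cvgZ R R^o _ _ Fz _ _ _ _ h1 h2).
Qed.

Let RN_locally_convex :
  exists2 B : set_system (RN R), (forall b, b \in B -> convex_set b) & basis B.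
Proof.
exists [set b | open b /\ convex_set b]; first by move=> b /set_mem[].
split=> [b []//|u].
set B := [set U | _].
have FF : Filter (filter_from B id).
  apply: filter_from_filter.
    exists setT; split=> //; split; first exact: openT.
    by move=> x y l _ _; exact: in_setT.
  move=> U V [[oU cU] Uu] [[oV cV] Vu]; exists (U `&` V) => //.
  split=> //; split; first exact: openI.
  move=> x y l /set_mem[Ux Vx] /set_mem[Uy Vy]; apply/mem_set; split.
    by apply/set_mem/cU; exact/mem_set.
  by apply/set_mem/cV; exact/mem_set.
apply: (proj2 (@RN_cvgP _ u FF)) => n A /= nA.
have [B0 cB0 [oB0 /(_ (u n) _ nA) [b [bB0 bu] bA]]] := @locally_convex R R^o.
exists ((fun v : RN R => v n : R^o) @^-1` b); last by move=> v; exact: bA.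
split=> //; split.
  by move/continuousP: (@RN_proj_continuous n); apply; exact: oB0.
move=> x y l /set_mem bx /set_mem by_; apply/mem_set.
by apply: (set_mem (cB0 _ (mem_set bB0) (x n) (y n) l _ _)); exact/mem_set.
Qed.

HB.instance Definition _ :=
  PreTopologicalNmodule_isTopologicalNmodule.Build (RN R) RN_add_continuous.
HB.instance Definition _ :=
  TopologicalNmodule_isTopologicalLmodule.Build R (RN R) RN_scale_continuous.
HB.instance Definition _ :=
  Uniform_isTvs.Build R (RN R) RN_locally_convex.

Lemma RN_hausdorff : hausdorff_space (RN R).
Proof. by apply: (@hausdorff_product nat (fun=> R^o)) => n; exact: Rhausdorff. Qed.

Lemma RN_metrizable (K : set (RN R)) : metrizable R K.
Proof.
apply: pseudometric_metrizable => x y xy; apply/val_inj/RN_hausdorff.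
move=> A B /= nA nB.
have [z [Az Bz]] := xy _ _ (initial_continuous nA) (initial_continuous nB).
by exists (set_val z).
Qed.

End RN_tvs.

Definition iota_seq (R : realType) (X : metricType R) (D : nat -> X) (x : X)
  : RN R := fun n => mdist x (D n).

(* As [0,1]^N is closed and convex in R^N, the closed convex hull in [0,1]^N is
   the one taken in R^N. *)
Definition Sprime (R : realType) (X : metricType R) (D : nat -> X) :
  set (RN R) := closed_convex_hull (range (iota_seq D)).

(* Sprime D and Sprime D' are affinely homeomorphic for any two dense sequences
   D and D', so the choice of D is immaterial. *)
Definition Sprime_is_simplex (R : realType) (X : metricType R) :=
  exists2 D : nat -> X, dense (range D) & choquet_simplex (Sprime D).

(* If diam X <= 1, every Sprime D is a compact metrizable convex set: only the
   last clause of choquet_simplex can fail for it. *)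
Section Sprime_compact_convex.
Variables (R : realType) (X : metricType R) (D : nat -> X).

Lemma Sprime_convex : convex_set (Sprime D).
Proof.
move=> x y l /set_mem hx /set_mem hy; apply/mem_set => C [[cC vC] sC].
by apply/set_mem/vC; apply/mem_set; [exact: hx|exact: hy].
Qed.

Lemma Sprime_closed : closed (Sprime D).
Proof. by apply: closed_bigI => C [[]]. Qed.

Lemma Sprime_cube : (diam X <= 1)%E ->
  Sprime D `<=` [set u : RN R | forall n, `[0, 1]%classic (u n)].
Proof.
move=> X1; apply: smallest_sub.
  split.
    rewrite [X in closed X](_ : _ = \bigcap_n
      ((fun u : RN R => u n : R^o) @^-1` `[0, 1]%classic)); last first.
      by apply/seteqP; split=> u h n; [move=> _; exact: h|exact: h].
    apply: closed_bigI => n _.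
    apply: (proj1 (continuous_closedP _)); first exact: RN_proj_continuous.
    exact: itv_closed.
  move=> x y l /set_mem hx /set_mem hy; apply/mem_set => n /=.
  move: (hx n) (hy n); rewrite /= !in_itv/= => /andP[x0 x1] /andP[y0 y1].
  have l0 : 0 <= l%:num by [].
  have l1 : 0 <= 1 - l%:num by rewrite subr_ge0.
  change (0 <= l%:num * x n + (1 - l%:num) * y n <= 1).
  rewrite addr_ge0 ?mulr_ge0//=.
  rewrite (@le_trans _ _ (l%:num * 1 + (1 - l%:num) * 1))//.
    by apply: lerD; apply: ler_wpM2l.
  by rewrite !mulr1 addrC subrK.
move=> _ [x _ <-] n /=; rewrite in_itv/= mdist_ge0/= -lee_fin.
by apply: le_trans X1; apply: ereal_sup_ubound; exists (x, D n).
Qed.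

Lemma Sprime_compact : (diam X <= 1)%E -> compact (Sprime D).
Proof.
move=> X1; apply: subclosed_compact (Sprime_cube X1); first exact: Sprime_closed.
apply: (@tychonoff nat (fun=> R^o) (fun=> `[0, 1]%classic)) => _.
exact: segment_compact.
Qed.

Lemma Sprime_choquet_simplexP : (diam X <= 1)%E ->
  choquet_simplex (Sprime D) <->
  forall x, Sprime D x -> uniquely_represented (Sprime D) x.
Proof.
move=> X1; split=> [[]//|h]; split=> //.
- exact: RN_hausdorff.
- exact: Sprime_convex.
- exact: Sprime_compact.
- exact: RN_metrizable.
Qed.

End Sprime_compact_convex.

(* Main.v *)
(** If two distinct pairs of points of [X] satisfy
    [d(x,a) + d(x,c) = d(x,b) + d(x,e)] for all [x], the segments joining their
    images in [S'(X)] share their midpoint. The images [iota p] are extreme in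
    [S'(X)]: every [u] in [S'(X)] satisfies [|u q - d(q,p)| <= u p], so a point
    of [S'(X)] vanishing at the coordinate of [p] is [iota p]. The common
    midpoint therefore has two representing measures on extreme points. The
    4-cycle with edges of length 1/2 realises this with its two diagonals. *)

From HB Require Import structures.
Require Import Defs.
From mathcomp Require Import all_boot all_order all_algebra.
From mathcomp Require Import all_classical all_reals all_analysis.
From mathcomp Require Import measurable_realfun ring lra.

Set Implicit Arguments.
Unset Strict Implicit.
Unset Printing Implicit Defensive.

Import Order.TTheory GRing.Theory Num.Theory.
Import numFieldNormedType.Exports.

Local Open Scope classical_set_scope.
Local Open Scope ring_scope.

(** * The half-half measure on two points and its integrals *)

Section midpoint_measure.
Variables (R : realType) (E : tvsType R) (u v : borel_tvs E).

Definition midpoint_measure : set (borel_tvs E) -> \bar R :=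
  mscale (2^-1)%:nng (measure_add (dirac u) (dirac v)).

HB.instance Definition _ := Measure.on midpoint_measure.

Lemma midpoint_measureE (A : set (borel_tvs E)) :
  midpoint_measure A = (2^-1 * ((u \in A)%:R + (v \in A)%:R))%:E.
Proof.
rewrite /midpoint_measure /mscale/= /msum !big_ord_recl big_ord0 adde0/=.
by rewrite /dirac !indicE.
Qed.

Let midpoint_measure_setT : midpoint_measure setT = 1%E.
Proof. by rewrite midpoint_measureE !in_setT -mulr2n mulVf. Qed.

HB.instance Definition _ :=
  Measure_isProbability.Build _ _ _ midpoint_measure midpoint_measure_setT.

Let ge0_integral_midpoint (f : borel_tvs E -> \bar R) :
  measurable_fun setT f -> (forall x, 0 <= f x)%E ->
  (\int[midpoint_measure]_x f x = (2^-1)%:E * (f u + f v))%E.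
Proof.
move=> mf f0; rewrite ge0_integral_mscale// ge0_integral_measure_add//.
by rewrite !integral_dirac// !diracT !mul1e.
Qed.

Lemma integral_midpoint (f : borel_tvs E -> R) : measurable_fun setT f ->
  (\int[midpoint_measure]_x (f x)%:E = (2^-1 * (f u + f v))%:E)%E.
Proof.
move=> /measurable_EFinP mf.
(* The formula for nonnegative integrands applies to the positive and negative parts separately;
   they recombine by [max(r, 0) - max(-r, 0) = r]. *)
rewrite integralE !ge0_integral_midpoint//; last 2 first.
- exact: measurable_funeneg.
- exact: measurable_funepos.
rewrite !funeposE !funenegE -!EFinN -!EFin_max.
suff -> : 2^-1 * (f u + f v) = 2^-1 * (Num.max (f u) 0 + Num.max (f v) 0) -
  2^-1 * (Num.max (- f u) 0 + Num.max (- f v) 0) by [].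
rewrite -mulrBr !maxElt; congr (_ * _).
by do 4 case: ltP => ?; lra.
Qed.

End midpoint_measure.

(** * Non-uniqueness of representing measures at a crossing of segments *)

Section borel_tvs.
Variables (R : realType) (E : tvsType R).

Lemma continuous_borel_measurable (f : E -> R^o) : continuous f ->
  measurable_fun setT (f : borel_tvs E -> R).
Proof.
move=> /continuousP cf.
apply: (measurability _ (RGenOpens.measurableE R)) => _ [_ [a [b ->] <-]].
rewrite setTI; apply: sub_sigma_algebra; apply: cf.
exact: interval_open.
Qed.

Lemma closed_borel_measurable (A : set E) : closed A ->
  measurable (A : set (borel_tvs E)).
Proof.
move=> cA; rewrite -(setCK A); apply: measurableC.
by apply: sub_sigma_algebra; exact: closed_openC.
Qed.

Lemma hausdorff_borel_set1 (x : E) : hausdorff_space E ->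
  measurable ([set x] : set (borel_tvs E)).
Proof.
move=> hE; apply: closed_borel_measurable.
exact/accessible_closed_set1/hausdorff_accessible.
Qed.

Lemma midpoint_barycenter (u v : E) :
  is_barycenter (midpoint_measure u v) (2^-1 *: (u + v)).
Proof.
move=> f cf; rewrite integral_midpoint; last exact: continuous_borel_measurable.
by rewrite linearZ linearD.
Qed.

(** The complement of the two points is a null set covering the complement of [extreme_points K],
    and it is Borel because points are closed. *)
Lemma midpoint_carried (K : set E) (u v : E) : hausdorff_space E ->
  extreme_points K u -> extreme_points K v ->
  carried_by_extreme_points K (midpoint_measure u v).
Proof.
move=> hE eu ev; exists (~` ([set u] `|` [set v])); split.
- by apply/measurableC/measurableU; exact: hausdorff_borel_set1.
- rewrite [LHS]midpoint_measureE !memNset ?addr0 ?mulr0//.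
    by apply; right.
  by apply; left.
- by move=> x; apply: contra_not => -[->|->].
Qed.

(** The midpoint measures of [a, b] and of [c, e] represent the same point, but the first charges
    [[set a]] and the second does not. *)
Lemma crossing_not_simplex (K : set E) (a b c e : E) :
  [/\ extreme_points K a, extreme_points K b, extreme_points K c
    & extreme_points K e] ->
  K (2^-1 *: (a + b)) -> a + b = c + e -> a <> c -> a <> e ->
  ~ choquet_simplex K.
Proof.
move=> [xa xb xc xe] Km abce ac ae [hE _ _ _ /(_ _ Km)[mu [_ _ mu_uniq]]].
have ma : measurable ([set a] : set (borel_tvs E)) by exact: hausdorff_borel_set1.
have := mu_uniq (midpoint_measure a b) (midpoint_carried hE xa xb)
  (midpoint_barycenter a b) _ ma.
rewrite -(mu_uniq (midpoint_measure c e) (midpoint_carried hE xc xe) _ _ ma).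
  rewrite [LHS]midpoint_measureE [RHS]midpoint_measureE (mem_set (erefl : [set a] a)).
  rewrite (memNset (nesym ac : ~ [set a] c)) (memNset (nesym ae : ~ [set a] e)).
  (* The mass of [[set a]] is 1 or 1/2, according to whether [b] equals [a], against 0. *)
  by move=> []; case: (b \in _) => /=; lra.
by rewrite abce; exact: midpoint_barycenter.
Qed.

End borel_tvs.

(** * Extreme points and crossing segments in the closed convex hull *)

Section Sprime.
Variables (R : realType) (X : metricType R) (D : nat -> X).

Lemma Sprime_iota x : Sprime D (iota_seq D x).
Proof. by move=> C [_]; apply; exists x. Qed.

Lemma Sprime_segment (u v : RN R) (t : R) : 0 <= t <= 1 ->
  Sprime D u -> Sprime D v -> Sprime D (t *: u + (1 - t) *: v).
Proof.
move=> t01 Su Sv.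
have := @Sprime_convex R X D u v (Itv01 (andP t01).1 (andP t01).2).
by move=> /(_ (mem_set Su) (mem_set Sv))/set_mem.
Qed.

(* The bound is the triangle inequality on the image of [X], and it cuts out a
   closed convex set. *)
Lemma Sprime_dist_le (u : RN R) m n : Sprime D u ->
  `|u m - mdist (D m) (D n)| <= u n.
Proof.
move=> /(_ [set w : RN R | `|w m - mdist (D m) (D n)| <= w n]); apply; split.
  split.
    (* Closedness: the set is the preimage of the nonnegative reals under the continuous [g]. *)
    pose g (w : RN R) : R^o := w n - `|w m - mdist (D m) (D n)|.
    have cg : continuous g.
      move=> w; have Fw : Filter (nbhs w) by exact: nbhs_filter.
      have cm := @RN_proj_continuous R m w.
      have cn := @RN_proj_continuous R n w.
      have cd := @cvg_cst R^o (mdist (D m) (D n)) _ (nbhs w) Fw.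
      have cmd := @cvgB R R^o _ _ Fw _ _ _ _ cm cd.
      exact: (@cvgB R R^o _ _ Fw _ _ _ _ cn (@cvg_norm R R^o _ _ Fw _ _ cmd)).
    rewrite [X in closed X](_ : _ = g @^-1` [set r : R^o | 0 <= r]).
      by apply: (proj1 (continuous_closedP _) cg); exact: closed_ge.
    by apply/seteqP; split => w /=; rewrite /g subr_ge0.
  move=> w z t /set_mem/= hw /set_mem/= hz; apply/mem_set => /=.
  change (`|t%:num * w m + (1 - t%:num) * z m - mdist (D m) (D n)| <=
    t%:num * w n + (1 - t%:num) * z n).
  have t0 : 0 <= t%:num by [].
  have t1 : 0 <= 1 - t%:num by rewrite subr_ge0.
  rewrite (_ : _ - _ = t%:num * (w m - mdist (D m) (D n)) +
    (1 - t%:num) * (z m - mdist (D m) (D n))); last by ring.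
  rewrite (le_trans (ler_normD _ _))// !normrM (ger0_norm t0) (ger0_norm t1).
  by rewrite lerD// ler_wpM2l.
move=> _ [x _ <-] /=; rewrite /iota_seq ler_distlC.
have h1 := metric_triangle (D m) x (D n).
have h2 := metric_triangle x (D n) (D m).
by move: h1 h2; rewrite (metric_sym (D m) x) (metric_sym (D n)); lra.
Qed.

(** Coordinate [n] is a linear functional whose minimum 0 over [Sprime D] is attained only at this
    point, which is thus exposed. *)
Lemma iota_extreme n : extreme_points (Sprime D) (iota_seq D (D n)).
Proof.
have Sprime_eq w : Sprime D w -> w n = 0 -> w = iota_seq D (D n).
  move=> Sw wn0; apply/funext => m; apply/eqP.
  rewrite /iota_seq (metric_sym (D n)) -subr_eq0 -normr_le0 -wn0.
  exact: Sprime_dist_le.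
(* Taking [m = n] in [Sprime_dist_le] puts an absolute value below [w n]. *)
have Sprime_ge0 w : Sprime D w -> 0 <= w n.
  by move=> /(Sprime_dist_le n n); apply: le_trans.
split; first exact: Sprime_iota.
move=> y z t Sy Sz /andP[t0 t1] yz.
have := congr1 (fun w : RN R => w n) yz.
rewrite {1}/iota_seq mdistxx => /esym.
change (t * y n + (1 - t) * z n = 0 -> y = iota_seq D (D n) /\ z = iota_seq D (D n)).
have y0 := Sprime_ge0 _ Sy; have z0 := Sprime_ge0 _ Sz.
have ty0 : 0 <= t * y n by rewrite mulr_ge0// ltW.
have tz0 : 0 <= (1 - t) * z n by rewrite mulr_ge0// subr_ge0 ltW.
move=> /eqP; rewrite paddr_eq0//.
rewrite !mulf_eq0 subr_eq0 (gt_eqF t0) (gt_eqF t1)/= => /andP[/eqP yn /eqP zn].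
by split; exact: Sprime_eq.
Qed.

Lemma Sprime_not_simplex i j k l :
  (forall x, mdist x (D i) + mdist x (D j) = mdist x (D k) + mdist x (D l)) ->
  D i != D k -> D i != D l -> ~ choquet_simplex (Sprime D).
Proof.
move=> ijkl ik il.
(* Coordinate [i] separates the images: it is 0 at [D i] and positive at any other point. *)
have iota_neq m : D i != D m -> iota_seq D (D i) <> iota_seq D (D m).
  move=> im /(congr1 (fun w : RN R => w i)); rewrite /iota_seq mdistxx => /esym.
  by move=> /mdist_positivity mi; rewrite mi eqxx in im.
apply: (@crossing_not_simplex _ _ _ (iota_seq D (D i)) (iota_seq D (D j))
  (iota_seq D (D k)) (iota_seq D (D l))).
- by split; exact: iota_extreme.
- rewrite scalerDr; have -> : (2^-1 : R) *: iota_seq D (D j) =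
    (1 - 2^-1) *: iota_seq D (D j) by congr (_ *: _); lra.
  by apply: Sprime_segment; [lra|exact: Sprime_iota..].
(* Coordinate [m] of this vector identity is the distance identity at [x = D m]. *)
- apply/funext => m; change (mdist (D i) (D m) + mdist (D j) (D m) =
    mdist (D k) (D m) + mdist (D l) (D m)).
  by rewrite ![mdist _ (D m)]metric_sym.
- exact: iota_neq.
- exact: iota_neq.
Qed.

End Sprime.

(* The 4-cycle with edges of length 1/2 is metrized by half the Hamming distance
   on two bits. The phantom parameter [R] carries the field of distances. *)
Definition cycle4 (R : realType) : Type := (bool * bool)%type.

(** * The 4-cycle as a metric space *)

Section cycle4.
Variable R : realType.

HB.instance Definition _ := Choice.on (cycle4 R).

Let dist (p q : cycle4 R) : R := ((p.1 != q.1)%:R + (p.2 != q.2)%:R) / 2.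

Let dist_xx p : dist p p = 0.
Proof. by rewrite /dist !eqxx addr0 mul0r. Qed.

Let dist_positivity p q : dist p q = 0 -> p = q.
Proof.
by case: p q => [[] []] [[] []]; rewrite /dist//= => ?; exfalso; lra.
Qed.

Let dist_sym p q : dist p q = dist q p.
Proof. by rewrite /dist eq_sym [p.2 == _]eq_sym. Qed.

Let dist_triangle q p r : dist p r <= dist p q + dist q r.
Proof.
by case: p q r => [[] []] [[] []] [[] []]; rewrite /dist/=; lra.
Qed.

HB.instance Definition _ := isMetric.Build R (cycle4 R)
  dist_xx dist_positivity dist_sym dist_triangle.

Lemma cycle4_mdistE (p q : cycle4 R) :
  mdist p q = ((p.1 != q.1)%:R + (p.2 != q.2)%:R) / 2.
Proof. by []. Qed.

Lemma cycle4_separable : separable (cycle4 R).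
Proof.
exists setT; last by move=> O O0 _; rewrite setIT.
by apply: finite_set_countable; exact: (@finite_finset (bool * bool)%type).
Qed.

Lemma cycle4_diam : diam (cycle4 R) = 1%E.
Proof.
apply/eqP; rewrite eq_le; apply/andP; split.
  apply: ge_ereal_sup => _ [[[[] []] [[] []]] _ <-];
    by rewrite lee_fin cycle4_mdistE/=; lra.
apply: ereal_sup_ubound; exists ((false, false), (true, true)) => //=.
by rewrite cycle4_mdistE/=; congr EFin; lra.
Qed.

(** Distinct points are at distance at least 1/2, so the open ball of radius 1/2 around [p] contains
    only [p]. *)
Lemma cycle4_dense_surj (D : nat -> cycle4 R) : dense (range D) ->
  forall p, exists n, D n = p.
Proof.
move=> dD p; have [||q [pq [n _ Dn]]] := dD (ball p (2^-1))^°.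
- by exists p; apply: nbhsx_ballx.
- exact: open_interior.
exists n; rewrite Dn; apply/esym; move: (interior_subset pq).
rewrite ballEmdist/= cycle4_mdistE.
by case: p q {pq Dn} => [[] []] [[] []] //= ?; exfalso; lra.
Qed.

Lemma cycle4_not_simplex : ~ Sprime_is_simplex (cycle4 R).
Proof.
move=> [D /cycle4_dense_surj sD].
(* The pairs [i, j] and [k, l] are the two diagonals; the distances from any vertex to the ends of a
   diagonal sum to 1. *)
have [i Di] := sD (false, false); have [j Dj] := sD (true, true).
have [k Dk] := sD (false, true); have [l Dl] := sD (true, false).
apply: (@Sprime_not_simplex _ _ D i j k l); rewrite ?Di ?Dj ?Dk ?Dl//.
by case=> [[] []]; rewrite !cycle4_mdistE/=; lra.
Qed.

End cycle4.

Theorem corollary3p2 (R : realType) :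
  (exists X : metricType R,
     [/\ [set: X] !=set0, separable X, diam X = 1%E & ~ Sprime_is_simplex X])
  /\ ~ (forall X : metricType R,
           [set: X] !=set0 -> separable X -> (diam X <= 1)%E ->
           Sprime_is_simplex X).
Proof.
have c0 : [set: cycle4 R] !=set0 by exists (false, false).
split.
  exists (cycle4 R); split=> //; first exact: cycle4_separable.
    exact: cycle4_diam.
  exact: cycle4_not_simplex.
move=> /(_ (cycle4 R) c0 (cycle4_separable R)).
by rewrite cycle4_diam lexx => /(_ isT); exact: cycle4_not_simplex.
Qed.
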